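(* Let $A_1,\dots,A_m,C$ be real symmetric $n\times n$ matrices and $b\in\mathbb{R}^m$, and assume that the semidefinite program $$(P)\qquad \inf\ \langle C,X\rangle\quad\text{s.t.}\quad \langle A_i,X\rangle=b_i\ (i=1,\dots,m),\quad X\succeq 0$$ is feasible. Suppose $y$ with some $\{y^i,U_i,V_i\}$ is feasible in the Ramana dual $(D_{\rm Ram})$ of $(P)$. Then there is an orthonormal matrix $Q\in\mathbb{R}^{n\times n}$ such that, after rotating $(P)$ by $Q$ (that is, after replacing all $A_i$ by $Q^\top A_iQ$, $C$ by $Q^\top CQ$, and correspondingly $U_i$ by $Q^\top U_iQ$ and $V_i$ by $Q^\top V_iQ$, with $y$ and the $y^i$ unchanged), the following hold: 1. $(\mathcal{A}^*y^1,\dots,\mathcal{A}^*y^{n-1})$ is a regular facial reduction sequence. 2. If the size of the positive definite block in $\mathcal{A}^*y^i$ is $r_i$ for all $i$, then $$U_1\in\mathcal{S}_+^{n,r_1},\quad U_2\in\mathcal{S}_+^{n,r_1+r_2},\quad\dots,\quad U_{n-1}\in\mathcal{S}_+^{n,r_1+\dots+r_{n-1}}.$$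
   Context: $\mathcal{S}^n$ is the set of real symmetric $n\times n$ matrices and $\mathcal{S}^n_+$ the set of positive semidefinite (psd) ones; $\mathcal{S}_+^{n,k}$ is the set of matrices in $\mathcal{S}^n_+$ in which only the upper left $k\times k$ block can be nonzero. $\langle S,T\rangle=\mathrm{trace}(ST)$ for symmetric matrices, $\langle b,y\rangle=b^\top y$ for vectors, and $\mathcal{A}^*y=\sum_{i=1}^m y_iA_i$ (after the rotation, $\mathcal{A}^*$ is formed with the rotated $A_i$). For $U\in\mathcal{S}^n_+$, $$\tan(U)=\Bigl\{W+W^\top : W\in\mathbb{R}^{n\times n},\ \begin{pmatrix} U & W \\ W^\top & R \end{pmatrix}\in\mathcal{S}^{2n}_+\ \text{for some } R\in\mathcal{S}^n_+\Bigr\}.$$ The Ramana dual $(D_{\rm Ram})$ is the problem $\sup\langle b,y\rangle$ over $y,y^1,\dots,y^{n-1}\in\mathbb{R}^m$ and symmetric $n\times n$ matrices $U_0,\dots,U_{n-1},V_0,\dots,V_{n-1}$, subject to $C-\mathcal{A}^*y\in\mathcal{S}^n_++\tan(U_{n-1})$, $U_0=V_0=0$, and, for $i=1,\dots,n-1$: $\mathcal{A}^*y^i=U_i+V_i$, $\langle b,y^i\rangle=0$, $U_i\in\mathcal{S}^n_+$, $V_i\in\tan(U_{i-1})$. A sequence $Y_1,\dots,Y_k\in\mathcal{S}^n$ is a regular facial reduction sequence for $\mathcal{S}^n_+$ if there are nonnegative integers $r_1,\dots,r_k$ with $r_1+\dots+r_k\le n$ and diagonal positive definite matrices $\Lambda_i$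 of order $r_i$ such that for each $i$, with respect to the partition of $\{1,\dots,n\}$ into consecutive blocks of sizes $r_1+\dots+r_{i-1}$, $r_i$, $n-(r_1+\dots+r_i)$, $$Y_i=\begin{pmatrix}\times&\times&\times\\ \times&\Lambda_i&0\\ \times&0&0\end{pmatrix},$$ where $\times$ denotes blocks with arbitrary entries (so $Y_1=\begin{pmatrix}\Lambda_1&0\\0&0\end{pmatrix}$). The block $\Lambda_i$ is called the positive definite block of $Y_i$ and $r_i$ its size; zero-size blocks are allowed. *)

(* Defs.v *)
From HB Require Import structures.
From mathcomp Require Import all_boot all_order all_algebra.
From mathcomp Require Import reals.
Set Implicit Arguments.
Unset Strict Implicit.
Unset Printing Implicit Defensive.
Import Order.TTheory GRing.Theory Num.Theory.
Local Open Scope ring_scope.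

Definition psdmx (R : realType) (n : nat) (S : 'M[R]_n) : Prop :=
  S \is symmetricmx /\ forall x : 'cV[R]_n, 0 <= (x^T *m S *m x) 0 0.

Definition pdmx (R : realType) (n : nat) (S : 'M[R]_n) : Prop :=
  S \is symmetricmx /\
  forall x : 'cV[R]_n, x != 0 -> 0 < (x^T *m S *m x) 0 0.

Definition psd_corner (R : realType) (n k : nat) (S : 'M[R]_n) : Prop :=
  psdmx S /\ forall p q : 'I_n, ~~ ((p < k)%N && (q < k)%N) -> S p q = 0.

Definition mxdot (R : realType) (n : nat) (S T : 'M[R]_n) : R := \tr (S *m T).

Definition vdot (R : realType) (m : nat) (b y : 'cV[R]_m) : R :=
  (b^T *m y) 0 0.

Definition adjA (R : realType) (m n : nat) (A : 'I_m -> 'M[R]_n)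
    (y : 'cV[R]_m) : 'M[R]_n :=
  \sum_(i < m) y i 0 *: A i.

Definition in_tan (R : realType) (n : nat) (U T : 'M[R]_n) : Prop :=
  exists W : 'M[R]_n,
    (exists2 S : 'M[R]_n, psdmx S & psdmx (block_mx U W W^T S)) /\
    T = W + W^T.

Definition primal_feasible (R : realType) (m n : nat) (A : 'I_m -> 'M[R]_n)
    (b : 'cV[R]_m) : Prop :=
  exists X : 'M[R]_n, (forall i : 'I_m, mxdot (A i) X = b i 0) /\ psdmx X.

(* Only ys i for 1 <= i <= n - 1 and U i, V i for 0 <= i <= n - 1 are
   constrained; the other values of these functions are irrelevant. *)
Record ramana_feasible (R : realType) (m n : nat) (A : 'I_m -> 'M[R]_n)
    (C : 'M[R]_n) (b y : 'cV[R]_m) (ys : nat -> 'cV[R]_m)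
    (U V : nat -> 'M[R]_n) : Prop := RamanaFeasible {
  ramana_sym : forall i : nat, (i < n)%N ->
    U i \is symmetricmx /\ V i \is symmetricmx;
  ramana_slack : exists S T : 'M[R]_n,
    [/\ psdmx S, in_tan (U n.-1) T & C - adjA A y = S + T];
  ramana_U0 : U 0%N = 0;
  ramana_V0 : V 0%N = 0;
  ramana_step : forall i : nat, (1 <= i <= n.-1)%N ->
    [/\ adjA A (ys i) = U i + V i, vdot b (ys i) = 0,
        psdmx (U i) & in_tan (U i.-1) (V i)]
}.

Definition block_end (r : nat -> nat) (i : nat) : nat :=
  (\sum_(1 <= j < i.+1) r j)%N.

(* The sequence is Y 1, ..., Y k.  Rows and columns are counted from 0, so the
   middle block of Y i has the indices p with
   block_end r i.-1 <= p < block_end r i; the first block of rows and columns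
   is left unconstrained. *)
Definition regfr_sizes (R : realType) (n k : nat) (Y : nat -> 'M[R]_n)
    (r : nat -> nat) : Prop :=
  (block_end r k <= n)%N /\
  forall i : nat, (1 <= i <= k)%N ->
    Y i \is symmetricmx /\
    exists L : 'M[R]_(r i),
      [/\ is_diag_mx L, pdmx L,
          forall (p q : 'I_n) (a c : 'I_(r i)),
            p = (block_end r i.-1 + a)%N :> nat ->
            q = (block_end r i.-1 + c)%N :> nat -> Y i p q = L a c
        & forall p q : 'I_n,
            (block_end r i.-1 <= p)%N -> (block_end r i.-1 <= q)%N ->
            (block_end r i <= p)%N || (block_end r i <= q)%N -> Y i p q = 0].

Definition regfr (R : realType) (n k : nat) (Y : nat -> 'M[R]_n) : Prop :=
  exists r : nat -> nat, regfr_sizes k Y r.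

Definition rotate (R : realType) (n : nat) (Q M : 'M[R]_n) : 'M[R]_n :=
  Q^T *m M *m Q.

(* Main.v *)
Require Import Defs.
From HB Require Import structures.
From mathcomp Require Import all_boot all_order all_algebra.
From mathcomp Require Import reals.
From mathcomp Require Import complex.
From mathcomp Require Import ring zify.
Set Implicit Arguments.
Unset Strict Implicit.
Unset Printing Implicit Defensive.
Import Order.TTheory GRing.Theory Num.Theory.
Local Open Scope ring_scope.

(** Write s_i = r_1 + ... + r_i.  The rotation is built one step at a time,
    from the following invariant: in the current coordinates U_1, ..., U_i are
    supported on their leading s_1, ..., s_i coordinates, and the sequence
    Y_j = A^* y^j is regular up to j = i.

    For the next step, look at the coordinates p >= s_i, which span a subspace
    of the kernel of U_i.  A matrix V_{i+1} in tan(U_i) vanishes as a quadratic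
    form on this kernel ([tan_kernel]), because a positive semidefinite matrix
    whose quadratic form vanishes at a vector kills that vector
    ([psdmx_kernel]).  Hence Y_{i+1} = U_{i+1} + V_{i+1} has the same trailing
    block as U_{i+1}, and this block is positive semidefinite.  The spectral
    theorem, applied inside the trailing coordinates with the positive
    eigenvalues listed first ([psd_tail_diagonalization]), brings it to the form
    diag(Lambda, 0) with Lambda positive definite: this is the shape required
    of Y_{i+1}, and the order of Lambda is r_{i+1}.  The quadratic form of
    U_{i+1} now vanishes at every coordinate vector p >= s_{i+1}, so the
    corresponding rows and columns of U_{i+1} vanish, which is the required
    support.  Finally the new rotation only moves coordinates p >= s_i, and it
    leaves the earlier structure intact: U_j and the trailing block
    diag(Lambda_j, 0) of Y_j, for j <= i, are supported on the coordinates that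
    it fixes ([rotate_fixes_supported]).

    The second claim speaks of every admissible choice of the sizes r_i.  There
    is only one: given s_{i-1}, the number r_i is the length of the run of
    positive diagonal entries with which the trailing block of Y_i begins
    ([pd_diag_block_end_inj]). *)

(** * Symmetric and positive semidefinite matrices *)

Lemma symmetricmxE (R : realType) n (M : 'M[R]_n) :
  M \is symmetricmx <-> M^T = M.
Proof.
rewrite qualifE /= expr0 scale1r map_mx_id //.
by split=> [/eqP <- | ->].
Qed.

Lemma dotmx_self (R : realType) n (x : 'cV[R]_n) :
  (x^T *m x) 0 0 = \sum_i x i 0 ^+ 2.
Proof. by rewrite mxE; apply: eq_bigr => i _; rewrite [X in X * _]mxE. Qed.

Lemma dotmx_self_ge0 (R : realType) n (x : 'cV[R]_n) : 0 <= (x^T *m x) 0 0.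
Proof. by rewrite dotmx_self sumr_ge0 // => i _; rewrite sqr_ge0. Qed.

Lemma dotmx_self_eq0 (R : realType) n (x : 'cV[R]_n) :
  (x^T *m x) 0 0 = 0 -> x = 0.
Proof.
rewrite dotmx_self => sum0; apply/colP=> i; rewrite [RHS]mxE; apply/eqP.
rewrite -sqrf_eq0; apply/eqP.
by apply: (psumr_eq0P _ sum0) => // j _; rewrite sqr_ge0.
Qed.

Lemma psdmx_rotate (R : realType) n (Q M : 'M[R]_n) :
  psdmx M -> psdmx (rotate Q M).
Proof.
rewrite /psdmx !symmetricmxE => -[symM psdM]; split=> [|x].
  by rewrite /rotate !trmx_mul trmxK symM mulmxA.
by have := psdM (Q *m x); rewrite /rotate trmx_mul !mulmxA.
Qed.

(** If z = M x were nonzero, moving from x a little in the direction - z would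
    make the quadratic form negative: its derivative there is - 2 |z|^2. *)
Lemma psdmx_kernel (R : realType) n (M : 'M[R]_n) (x : 'cV[R]_n) :
  psdmx M -> (x^T *m M *m x) 0 0 = 0 -> M *m x = 0.
Proof.
move=> [/symmetricmxE symM psdM] xMx; pose z := M *m x.
have xM : x^T *m M = z^T by rewrite trmx_mul symM.
pose a := (z^T *m z) 0 0; pose c := (z^T *m M *m z) 0 0.
have c_ge0 : 0 <= c := psdM z.
(* Nonnegativity of the quadratic form of M at x - t z. *)
have quad t : 0 <= c * t ^+ 2 - 2 * t * a.
  have := psdM (x - t *: z).
  rewrite -mulmxA linearB /= linearZ /= mulmxBr -scalemxAr -/z.
  rewrite mulmxBl !mulmxBr -!scalemxAl -!scalemxAr [x^T *m (M *m z)]mulmxA xM.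
  have xz : (x^T *m z) 0 0 = 0 by rewrite mulmxA.
  have zMz : (z^T *m (M *m z)) 0 0 = c by rewrite mulmxA.
  have zz : (z^T *m z) 0 0 = a by [].
  move: (x^T *m z) xz (z^T *m (M *m z)) zMz (z^T *m z) zz => P P0 Q Qc S Sa.
  rewrite !mxE P0 Qc Sa; congr (0 <= _); ring.
suff a0 : a = 0 by exact: dotmx_self_eq0.
have c1_gt0 : 0 < c + 1 by rewrite ltr_wpDl.
(* The minimizer would be t = a / c; adding 1 covers the case c = 0. *)
have := quad (a / (c + 1)).
have -> : c * (a / (c + 1)) ^+ 2 - 2 * (a / (c + 1)) * a =
          - (a ^+ 2 * ((c + 2) / (c + 1) ^+ 2)) by field; rewrite gt_eqF.
have ratio_gt0 : 0 < (c + 2) / (c + 1) ^+ 2.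
  by rewrite divr_gt0 ?exprn_gt0 // ltr_wpDl.
rewrite oppr_ge0 pmulr_lle0 //.
by move=> a2; apply/eqP; rewrite -sqrf_eq0 eq_le a2 sqr_ge0.
Qed.

Lemma psdmx_kernel_mx (R : realType) n k (M : 'M[R]_n) (K : 'M[R]_(n, k)) :
  psdmx M -> K^T *m M *m K = 0 -> M *m K = 0.
Proof.
move=> psdM KMK; apply/matrixP=> i j.
have : M *m (K *m delta_mx j (0 : 'I_1)) = 0.
  apply: psdmx_kernel => //; rewrite trmx_mul mulmxA.
  by rewrite -[_ *m M]mulmxA -[_ *m K]mulmxA KMK mulmx0 mul0mx mxE.
by rewrite mulmxA -colE => /colP /(_ i); rewrite !mxE.
Qed.

(** The quadratic form of the block matrix with blocks U, W, W^T, S vanishes at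
    (x, 0) for x in the kernel of U, so this matrix kills (x, 0); its second
    block row then says that W^T x = 0. *)
Lemma tan_kernel (R : realType) n k (U V : 'M[R]_n) (K : 'M[R]_(n, k)) :
  in_tan U V -> U *m K = 0 -> K^T *m V *m K = 0.
Proof.
case=> W [[S _ psdB] ->] UK.
have WK : W^T *m K = 0.
  have : block_mx U W W^T S *m col_mx K 0 = 0.
    apply: psdmx_kernel_mx => //; rewrite -mulmxA mul_block_col tr_col_mx.
    by rewrite mul_row_col UK !mulmx0 trmx0 mul0mx !addr0 mulmx0.
  by rewrite mul_block_col UK !mulmx0 !addr0 -col_mx0 => /eq_col_mx[].
rewrite mulmxDr mulmxDl -[_ *m W^T *m K]mulmxA WK mulmx0 addr0.
by rewrite -[K^T *m W]trmxK trmx_mul trmxK WK trmx0 mul0mx.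
Qed.

(** * Rotations *)

Lemma rotateM (R : realType) n (P Q M : 'M[R]_n) :
  rotate (P *m Q) M = rotate Q (rotate P M).
Proof. by rewrite /rotate trmx_mul !mulmxA. Qed.

Lemma rotateD (R : realType) n (Q M N : 'M[R]_n) :
  rotate Q (M + N) = rotate Q M + rotate Q N.
Proof. by rewrite /rotate mulmxDr mulmxDl. Qed.

Lemma rotate1 (R : realType) n (M : 'M[R]_n) : rotate 1%:M M = M.
Proof. by rewrite /rotate trmx1 mul1mx mulmx1. Qed.

Lemma tr_rotate (R : realType) n (Q M : 'M[R]_n) :
  (rotate Q M)^T = rotate Q M^T.
Proof. by rewrite /rotate !trmx_mul trmxK mulmxA. Qed.

Lemma adjA_rotate (R : realType) m n (Q : 'M[R]_n) (A : 'I_m -> 'M[R]_n) y :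
  adjA (fun i => rotate Q (A i)) y = rotate Q (adjA A y).
Proof.
rewrite /rotate /adjA mulmx_sumr mulmx_suml; apply: eq_bigr => i _.
by rewrite -scalemxAr -scalemxAl.
Qed.

(** Compressing M to the orthogonal complement of a unit eigenvector e subtracts
    the rank-one term of e.  In this form the deflated matrix is visibly
    positive semidefinite when M is. *)
Lemma rotate_deflate (R : realType) n (M : 'M[R]_n) (e : 'cV[R]_n) l :
  M^T = M -> e^T *m e = 1%:M -> M *m e = l *: e ->
  rotate (1%:M - e *m e^T) M = M - l *: (e *m e^T).
Proof.
move=> symM ee Me; set E := 1%:M - _.
have symE : E^T = E by rewrite /E linearB /= trmx1 trmx_mul trmxK.
have ME : M *m E = M - l *: (e *m e^T).
  by rewrite /E mulmxBr mulmx1 mulmxA Me scalemxAl.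
have eM : e^T *m M = l *: e^T.
  by apply: trmx_inj; rewrite trmx_mul trmxK linearZ /= trmxK symM.
rewrite /rotate symE -mulmxA ME /E mulmxBl mul1mx -[in X in _ - X]mulmxA.
rewrite [e^T *m (_ - _)]mulmxBr eM -scalemxAr mulmxA ee mul1mx subrr mulmx0.
by rewrite subr0.
Qed.

(** * Leading and trailing coordinates *)

Definition lead_proj (R : realType) n (s : nat) : 'M[R]_n :=
  diag_mx (\row_p (p < s)%:R).

Definition tail_proj (R : realType) n (s : nat) : 'M[R]_n :=
  1%:M - lead_proj R n s.

Lemma mulmx_leadE (R : realType) n s (M : 'M[R]_n) p q :
  (M *m lead_proj R n s) p q = if (q < s)%N then M p q else 0.
Proof. by rewrite mul_mx_diag !mxE; case: ifP; rewrite ?mulr1 ?mulr0. Qed.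

Lemma tr_lead (R : realType) n s : (lead_proj R n s)^T = lead_proj R n s.
Proof. exact: tr_diag_mx. Qed.

Lemma lead_full (R : realType) n s : (n <= s)%N -> lead_proj R n s = 1%:M.
Proof.
move=> le_ns; rewrite -diag_const_mx; congr diag_mx.
by apply/rowP=> p; rewrite !mxE (leq_trans (ltn_ord p)).
Qed.

Lemma mul_lead (R : realType) n s t : (s <= t)%N ->
  lead_proj R n t *m lead_proj R n s = lead_proj R n s.
Proof.
move=> le_st; apply/matrixP=> p q; rewrite mulmx_leadE.
case: ifP => [q_s | q_s]; rewrite !mxE.
  by have [-> | //] := eqVneq p q; rewrite q_s (leq_trans q_s le_st).
by have [-> | //] := eqVneq p q; rewrite q_s.
Qed.

Lemma mul_tail (R : realType) n s t : (s <= t)%N ->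
  tail_proj R n s *m tail_proj R n t = tail_proj R n t.
Proof.
move=> le_st; rewrite /tail_proj mulmxBr mulmx1 mulmxBl mul1mx.
have -> : lead_proj R n s *m lead_proj R n t = lead_proj R n s.
  by apply: trmx_inj; rewrite trmx_mul !tr_lead mul_lead.
by rewrite opprB addrA subrK.
Qed.

Lemma rotate_tailE (R : realType) n s (M : 'M[R]_n) p q :
  rotate (tail_proj R n s) M p q =
  if (s <= p)%N && (s <= q)%N then M p q else 0.
Proof.
have tailr (N : 'M[R]_n) i j :
    (N *m tail_proj R n s) i j = if (s <= j)%N then N i j else 0.
  rewrite /tail_proj mulmxBr mulmx1 [LHS]mxE [X in _ + X]mxE mulmx_leadE.
  rewrite [(s <= j)%N]leqNgt.
  by case: (j < s)%N; rewrite ?subrr ?subr0.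
have -> : rotate (tail_proj R n s) M =
    ((M *m tail_proj R n s)^T *m tail_proj R n s)^T.
  by rewrite trmx_mul trmxK /rotate mulmxA.
by rewrite mxE tailr mxE tailr; case: (s <= p)%N.
Qed.

(** A vanishing trailing block of a positive semidefinite matrix forces the
    off-diagonal blocks to vanish as well. *)
Lemma tail_vanish_corner (R : realType) n t (M : 'M[R]_n) : psdmx M ->
  rotate (tail_proj R n t) M = 0 -> M *m lead_proj R n t = M.
Proof.
move=> psdM /(psdmx_kernel_mx psdM); rewrite /tail_proj mulmxBr mulmx1.
by move/eqP; rewrite subr_eq0 => /eqP <-.
Qed.

(** For orthogonal H, fixing the first s coordinate vectors already forces H to
    be the direct sum of the identity of order s and an orthogonal matrix. *)
Definition fixes_lead (R : realType) n (s : nat) (H : 'M[R]_n) : Prop :=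
  H^T *m H = 1%:M /\ H *m lead_proj R n s = lead_proj R n s.

Lemma fixes_lead_le (R : realType) n s t (H : 'M[R]_n) : (s <= t)%N ->
  fixes_lead t H -> fixes_lead s H.
Proof.
by move=> le_st [HH Hl]; split=> //; rewrite -(mul_lead R n le_st) mulmxA Hl.
Qed.

Lemma lead_fixes (R : realType) n s (H : 'M[R]_n) :
  fixes_lead s H -> lead_proj R n s *m H = lead_proj R n s.
Proof.
case=> HH Hl; have : (H *m lead_proj R n s)^T *m H = lead_proj R n s.
  by rewrite trmx_mul -mulmxA HH mulmx1 tr_lead.
by rewrite Hl tr_lead.
Qed.

(** Taking trailing blocks commutes with H, as H commutes with the projection
    onto the trailing coordinates. *)
Lemma rotate_tail_fixes (R : realType) n s (H M : 'M[R]_n) :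
  fixes_lead s H ->
  rotate (tail_proj R n s) (rotate H M) = rotate H (rotate (tail_proj R n s) M).
Proof.
move=> fixH; rewrite -!rotateM; congr (rotate _ M).
by rewrite /tail_proj mulmxBl mulmxBr mulmx1 mul1mx (lead_fixes fixH) fixH.2.
Qed.

Lemma rotate_fixes_supported (R : realType) n s (H M : 'M[R]_n) :
  fixes_lead s H -> M^T = M -> M *m lead_proj R n s = M -> rotate H M = M.
Proof.
move=> fixH symM Ml.
have MH : M *m H = M by rewrite -Ml -mulmxA (lead_fixes fixH).
by rewrite /rotate -mulmxA MH -[RHS]symM -[in RHS]MH trmx_mul symM.
Qed.

Definition pd_diag_block (R : realType) n (s t : nat) (D : 'M[R]_n) : Prop :=
  forall p q : 'I_n,
    if (p == q) && (s <= p < t)%N then (0 < D p q : Prop) else D p q = 0.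

Lemma pd_diag_block_sym (R : realType) n s t (D : 'M[R]_n) :
  pd_diag_block s t D -> D^T = D.
Proof.
move=> blkD; apply/matrixP=> p q; rewrite mxE.
have [-> // | neq_pq] := eqVneq p q.
have := blkD p q; have := blkD q p; rewrite eq_sym (negPf neq_pq) /=.
by move=> -> ->.
Qed.

Lemma pd_diag_block_lead (R : realType) n s t (D : 'M[R]_n) :
  pd_diag_block s t D -> D *m lead_proj R n t = D.
Proof.
move=> blkD; apply/matrixP=> p q; rewrite mulmx_leadE.
case: ifPn => // q_t; have := blkD p q; case: ifP => // /andP[/eqP-> /andP[_]].
by rewrite (negPf q_t).
Qed.

(** If t < u, the diagonal entry of D at t would be both zero and positive. *)
Lemma pd_diag_block_end_inj (R : realType) n s t u (D : 'M[R]_n) :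
  (s <= t <= n)%N -> (s <= u <= n)%N ->
  pd_diag_block s t D -> pd_diag_block s u D -> t = u.
Proof.
wlog lt_tu : t u / (t < u)%N => [IH|].
  have [/IH h|/IH h|//] := ltngtP t u => *; first exact: h.
  by symmetry; apply: h.
move=> /andP[s_t t_n] /andP[s_u u_n] blkt blku.
have t_lt : (t < n)%N by lia.
have := blkt (Ordinal t_lt) (Ordinal t_lt).
have := blku (Ordinal t_lt) (Ordinal t_lt).
rewrite eqxx /= s_t lt_tu ltnn /= => pos zero.
by rewrite zero ltxx in pos.
Qed.

(** * Diagonalization inside the trailing coordinates *)

(** Over the complex numbers M is hermitian, hence unitarily diagonalizable with
    a real spectrum; as M is nonzero, so is some eigenvalue.  Being real, it is
    a root of the characteristic polynomial over R already, which yields a real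
    eigenvector. *)
Lemma symmetric_nonzero_eigenvalue (R : realType) n (M : 'M[R]_n) :
  M^T = M -> M != 0 ->
  exists l : R, exists2 v : 'cV[R]_n, l != 0 /\ v != 0 & M *m v = l *: v.
Proof.
move=> symM M_neq0.
pose f := real_complex R.
pose N := map_mx f M.
have hermN : N \is hermsymmx.
  apply: realsym_hermsym.
    by rewrite qualifE /= expr0 scale1r map_mx_id // /N map_trmx symM.
  by apply/mxOverP=> i j; rewrite mxE; apply/complex_realP; exists (M i j).
have [diagN_eq0 | diagN_neq0] := eqVneq (spectral_diag N) 0.
  case/negP: M_neq0; apply/eqP.
  have NE := orthomx_spectralP (hermitian_normalmx hermN).
  rewrite diagN_eq0 in NE.
  have : N = 0 by rewrite NE linear0 mulmx0 mul0mx.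
  by move/eqP; rewrite map_mx_eq0 => /eqP.
have /rV0Pn[j dj_neq0] := diagN_neq0.
have /mxOverP /(_ 0 j) /complex_realP[l lE] :=
  hermitian_spectral_diag_real hermN.
have l_eig : eigenvalue N (f l).
  have unitS := spectral_unit N.
  apply/eigenvalueP; exists (row j (spectralmx N)); rewrite rowE.
    rewrite {2}(orthomx_spectralP (hermitian_normalmx hermN)) !mulmxA mulmxK //.
    rewrite scalemxAl /f -lE; congr (_ *m _); apply/rowP=> k.
    rewrite mul_mx_diag !mxE eqxx /=.
    by have [-> | _] := eqVneq k j; rewrite ?mulr1 ?mul1r ?mulr0 ?mul0r.
  apply: contra_neq (oner_neq0 R[i]) => delta0.
  have := congr1 (fun w => (w *m invmx (spectralmx N)) 0 j) delta0.
  by rewrite mulmxK // mul0mx !mxE !eqxx.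
have : eigenvalue M l.
  by move: l_eig; rewrite !eigenvalue_root_char /N -map_char_poly fmorph_root.
case/eigenvalueP=> v vM v_neq0.
exists l; exists v^T; last by rewrite -{1}symM -trmx_mul vM linearZ.
split; last by rewrite trmx_eq0.
by apply: contraNneq dj_neq0 => l0; rewrite lE l0.
Qed.

Lemma psdmx_unit_eigenvector (R : realType) n (M : 'M[R]_n) :
  psdmx M -> M != 0 ->
  exists l : R, exists v : 'cV[R]_n,
    [/\ 0 < l, v^T *m v = 1%:M & M *m v = l *: v].
Proof.
move=> [/symmetricmxE symM psdM] M_neq0.
have [l [v0 [l_neq0 v0_neq0] Mv0]] := symmetric_nonzero_eigenvalue symM M_neq0.
pose nv := (v0^T *m v0) 0 0.
have nv_gt0 : 0 < nv.
  rewrite lt_def dotmx_self_ge0 andbT.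
  by apply: contra_neq v0_neq0; exact: dotmx_self_eq0.
exists l, ((Num.sqrt nv)^-1 *: v0); split.
- rewrite lt_def l_neq0 /= -(pmulr_lge0 _ nv_gt0).
  by have := psdM v0; rewrite -mulmxA Mv0 -scalemxAr mxE.
- rewrite [(_ *: v0)^T]linearZ /= -scalemxAl -scalemxAr scalerA.
  rewrite [v0^T *m v0]mx11_scalar -/nv -invfM -expr2 sqr_sqrtr ?ltW //.
  by rewrite scale_scalar_mx mulVf // gt_eqF.
by rewrite -scalemxAr Mv0 scalerA mulrC -scalerA.
Qed.

(** Two vectors of equal length are exchanged by the reflection G in the
    hyperplane orthogonal to w = u - v.  The last clause holds because a matrix
    K that does not separate u from v kills w; it is what allows the reflection
    to be confined to the trailing coordinates. *)
Lemma householder (R : realType) n (u v : 'cV[R]_n) : u^T *m u = v^T *m v ->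
  exists G : 'M[R]_n, [/\ G^T = G, G *m G = 1%:M, G *m u = v &
    forall k (K : 'M[R]_(k, n)), K *m u = K *m v -> K *m G = K].
Proof.
move=> norm_uv; pose w := u - v.
have vu : v^T *m u = u^T *m v.
  by rewrite [v^T *m u]mx11_scalar -tr_scalar_mx -mx11_scalar trmx_mul trmxK.
pose d := (w^T *m u) 0 0; pose G := 1%:M - d^-1 *: (w *m w^T).
have wu : w^T *m u = d%:M by exact: mx11_scalar.
have ww : w^T *m w = (d *+ 2)%:M.
  have wv : w^T *m v = - (w^T *m u).
    by rewrite /w linearB /= !mulmxBl vu norm_uv opprB.
  by rewrite /w mulmxBr -/w wv opprK -mulr2n wu raddfMn.
(* d = |u - v|^2 / 2 vanishes only if u = v, and then G = 1 will do. *)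
have [d0 | d_neq0] := eqVneq d 0.
  have uv : u = v.
    apply/eqP; rewrite -subr_eq0 -/w; apply/eqP; apply: dotmx_self_eq0.
    by rewrite ww d0 mul0rn mxE mul0rn.
  exists 1%:M; split; rewrite ?trmx1 ?mulmx1 ?mul1mx //.
  by move=> k K _; rewrite mulmx1.
exists G; split.
- by rewrite /G linearB linearZ /= trmx1 trmx_mul trmxK.
- rewrite /G mulmxBl mul1mx mulmxBr mulmx1 -scalemxAl -scalemxAr.
  rewrite mulmxA -[w *m w^T *m w]mulmxA ww mul_mx_scalar -scalemxAl !scalerA.
  rewrite [d^-1 * (d *+ 2)]mulrnAr mulVf // mulrnAr mulr1 -scalerMnl.
  by rewrite mulr2n opprB addrK subrK.
- rewrite /G mulmxBl mul1mx -scalemxAl -mulmxA wu mul_mx_scalar scalerA.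
  by rewrite mulVf // scale1r /w opprB addrC subrK.
- move=> k K Kuv; rewrite /G mulmxBr mulmx1 -scalemxAr mulmxA /w mulmxBr Kuv.
  by rewrite subrr mul0mx scaler0 subr0.
Qed.

(** Spectral theorem for a positive semidefinite N living on the coordinates
    p >= s, by a rotation that moves only these coordinates.  By induction on
    n - s: if N is nonzero, reflect a unit eigenvector with positive eigenvalue
    onto the coordinate vector s, split off its rank-one term, and continue with
    the coordinates p >= s + 1.  Choosing a positive eigenvalue at each stage
    puts the positive diagonal entries in front. *)
Lemma psd_tail_diagonalization (R : realType) n s (N : 'M[R]_n) :
  psdmx N -> N *m lead_proj R n s = 0 -> (s <= n)%N ->
  exists H : 'M[R]_n, exists t : nat,
    [/\ fixes_lead s H, (s <= t <= n)%N & pd_diag_block s t (rotate H N)].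
Proof.
move E : (n - s)%N => d; elim: d s E N => [|d IHd] s E N psdN Ns le_sn.
  exists 1%:M, s; split; rewrite ?leqnn //.
    by split; rewrite ?trmx1 mul1mx.
  move=> p q; rewrite rotate1; case: ifP => [|_]; first by lia.
  move: Ns; rewrite lead_full; last by lia.
  by rewrite mulmx1 => ->; rewrite mxE.
(* With no positive eigenvalue left the block ends here: t = s. *)
have [N0 | N_neq0] := eqVneq N 0.
  exists 1%:M, s; split; rewrite ?leqnn //.
    by split; rewrite ?trmx1 mul1mx.
  by move=> p q; rewrite rotate1; case: ifP => [|_]; [lia | rewrite N0 mxE].
have symN : N^T = N by apply/symmetricmxE; case: psdN.
have sN : lead_proj R n s *m N = 0.
  by apply: trmx_inj; rewrite trmx_mul tr_lead symN Ns trmx0.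
have [l [v [l_gt0 vv Nv]]] := psdmx_unit_eigenvector psdN N_neq0.
have l_neq0 : l != 0 by rewrite gt_eqF.
have lt_sn : (s < n)%N by lia.
pose i0 := Ordinal lt_sn.
pose e : 'cV[R]_n := delta_mx i0 0.
have ee : e^T *m e = 1%:M.
  by rewrite trmx_delta mul_delta_mx; apply/matrixP=> p q; rewrite !ord1 !mxE.
have leadS : lead_proj R n s.+1 = lead_proj R n s + e *m e^T.
  rewrite trmx_delta mul_delta_mx; apply/matrixP=> p q; rewrite !mxE.
  rewrite -[p == i0]val_eqE -[q == i0]val_eqE -val_eqE /=.
  have [->|neq_pq] := eqVneq (p : nat) q; last first.
    rewrite !mulr0n add0r; case: eqP => //= ps; case: eqP => //= qs.
    by move: neq_pq; rewrite ps qs eqxx.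
  by rewrite ltnS leq_eqVlt; case: ltngtP; rewrite ?addr0 ?add0r.
have se : lead_proj R n s *m e = 0.
  apply/colP=> p; rewrite mul_diag_mx !mxE -val_eqE /= andbT.
  by have [-> | ] := eqVneq (p : nat) s; rewrite ?ltnn ?mul0r ?mulr0.
(* An eigenvector for a nonzero eigenvalue lies in the range of N, hence in
   the trailing coordinates. *)
have sv : lead_proj R n s *m v = 0.
  have : l *: (lead_proj R n s *m v) = 0.
    by rewrite scalemxAr -Nv mulmxA sN mul0mx.
  by move/eqP; rewrite scaler_eq0 (negPf l_neq0) => /eqP.
have [G [symG GG Gv KG]] := householder (etrans vv (esym ee)).
have sG : lead_proj R n s *m G = lead_proj R n s by apply: KG; rewrite sv se.
have Gs : G *m lead_proj R n s = lead_proj R n s.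
  by apply: trmx_inj; rewrite trmx_mul tr_lead symG.
pose M := rotate G N.
have Me : M *m e = l *: e.
  rewrite /M /rotate symG -Gv -!mulmxA [G *m (G *m v)]mulmxA GG mul1mx Nv.
  by rewrite -scalemxAr.
pose E1 := 1%:M - e *m e^T.
have M'E : rotate E1 M = M - l *: (e *m e^T).
  by apply: rotate_deflate; rewrite // tr_rotate symN.
have Me1 : rotate E1 M *m lead_proj R n s.+1 = 0.
  rewrite leadS mulmxDr M'E !mulmxBl -!scalemxAl.
  rewrite -[e *m e^T *m lead_proj R n s]mulmxA.
  have -> : e^T *m lead_proj R n s = 0.
    by apply: trmx_inj; rewrite trmx_mul trmxK tr_lead se trmx0.
  rewrite mulmx0 scaler0 subr0 mulmxA Me -[e *m e^T *m _]mulmxA.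
  rewrite [e^T *m (e *m _)]mulmxA ee mul1mx scalemxAl subrr addr0.
  by rewrite /M /rotate -!mulmxA Gs Ns mulmx0.
have [H [t [fixH /andP[s_t t_n] blkH]]] :
    exists H : 'M[R]_n, exists t : nat,
      [/\ fixes_lead s.+1 H, (s.+1 <= t <= n)%N &
          pd_diag_block s.+1 t (rotate H (rotate E1 M))].
  by apply: IHd => //; [lia | do 2 apply: psdmx_rotate].
have fixHs := fixes_lead_le (leqnSn s) fixH.
have He : H *m e = e.
  have eE : lead_proj R n s.+1 *m e = e.
    by rewrite leadS mulmxDl se add0r -mulmxA ee mulmx1.
  by rewrite -eE mulmxA fixH.2.
exists (G *m H), t; split.
- split; last by rewrite -mulmxA fixHs.2.
  by rewrite trmx_mul symG mulmxA -[_ *m G *m G]mulmxA GG mulmx1 fixH.1.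
- by rewrite t_n (ltnW s_t).
have -> : rotate (G *m H) N = rotate H (rotate E1 M) + l *: (e *m e^T).
  have HTe : H^T *m e = e by rewrite -{1}He mulmxA fixH.1 mul1mx.
  have eH : e^T *m H = e^T by rewrite -[in RHS]HTe trmx_mul trmxK.
  have ME : M = rotate E1 M + l *: (e *m e^T) by rewrite M'E subrK.
  rewrite rotateM -/M {1}ME rotateD; congr (_ + _).
  by rewrite /rotate -scalemxAr -scalemxAl mulmxA HTe -mulmxA eH.
move=> p q; rewrite trmx_delta mul_delta_mx.
have -> : (rotate H (rotate E1 M) + l *: delta_mx i0 i0) p q =
          rotate H (rotate E1 M) p q + l * ((p == i0) && (q == i0))%:R.
  by rewrite [LHS]mxE; congr (_ + _); rewrite !mxE.
have := blkH p q.
have [-> | neq_pq] := eqVneq p q => /=; last first.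
  move=> ->; rewrite add0r; case: eqP => [p0|]; rewrite ?mulr0 //=.
  by case: eqP => [q0|]; rewrite ?mulr0 //; case/negP: neq_pq; rewrite p0 q0.
rewrite andbb -val_eqE /=.
have [-> | neq_qs] := eqVneq (q : nat) s.
  by rewrite ltnn leqnn s_t /= => ->; rewrite add0r mulr1.
by rewrite mulr0 addr0 [(s <= q)%N]leq_eqVlt eq_sym (negPf neq_qs).
Qed.

(** * The rotation *)

(** The invariant of the construction.  The sizes r_i are represented by their
    partial sums s_i, and the arbitrary first block of rows and columns of Y_i
    is discarded by compressing Y_i to the coordinates p >= s_{i-1}. *)
Definition regular_rotation (R : realType) n (Y U : nat -> 'M[R]_n)
    (k : nat) (Q : 'M[R]_n) (s : nat -> nat) : Prop :=
  [/\ Q^T *m Q = 1%:M, s 0%N = 0%N,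
      forall i, (s i <= s i.+1 <= n)%N,
      forall i, (1 <= i <= k)%N ->
        pd_diag_block (s i.-1) (s i)
          (rotate (tail_proj R n (s i.-1)) (rotate Q (Y i)))
    & forall i, (i <= k)%N ->
        rotate Q (U i) *m lead_proj R n (s i) = rotate Q (U i)].

(** The step from k to k + 1 composes the rotation found so far with one that
    fixes the first s_k coordinates and diagonalizes the trailing block of
    U_{k+1}, which is also the trailing block of Y_{k+1}. *)
Lemma regular_rotation_exists (R : realType) n (Y U V : nat -> 'M[R]_n) k :
  U 0%N = 0 ->
  (forall i, (1 <= i <= k)%N ->
    [/\ Y i = U i + V i, psdmx (U i) & in_tan (U i.-1) (V i)]) ->
  exists Q s, regular_rotation Y U k Q s.
Proof.
move=> U0; elim: k => [|k IHk] step.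
  exists 1%:M, (fun=> 0%N); split=> //; first by rewrite trmx1 mul1mx.
    by move=> i; lia.
  by case=> // _; rewrite U0 rotate1 mul0mx.
have [|Q [s [QQ s0 s_mono blkY cornU]]] := IHk.
  by move=> i ik; apply: step; lia.
pose a := s k; pose N := rotate (tail_proj R n a) (rotate Q (U k.+1)).
have [Yk psdUk tanV] : [/\ Y k.+1 = U k.+1 + V k.+1, psdmx (U k.+1) &
  in_tan (U k) (V k.+1)] by apply: (step k.+1); lia.
have s_le i j : (i <= j)%N -> (s i <= s j)%N.
  apply: (homo_leq (r := leq) leqnn leq_trans) => j'.
  by case/andP: (s_mono j').
have [H [t [fixH /andP[a_t t_n] blkN]]] : exists H : 'M[R]_n, exists t : nat,
    [/\ fixes_lead a H, (a <= t <= n)%N & pd_diag_block a t (rotate H N)].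
  apply: psd_tail_diagonalization; first by do 2 apply: psdmx_rotate.
    rewrite /N /rotate -mulmxA /tail_proj mulmxBl mul1mx mul_lead // subrr.
    by rewrite mulmx0.
  rewrite /a; case: (k) s_mono => [|j] sm; first by rewrite s0.
  by case/andP: (sm j).
have tailQH M : rotate (tail_proj R n a) (rotate (Q *m H) M) =
    rotate H (rotate (tail_proj R n a) (rotate Q M)).
  by rewrite rotateM rotate_tail_fixes.
have QHQH : (Q *m H)^T *m (Q *m H) = 1%:M.
  by rewrite trmx_mul mulmxA -[_ *m Q^T *m Q]mulmxA QQ mulmx1 fixH.1.
have symU i : (i <= k)%N -> (U i)^T = U i.
  case: i => [|i] le_ik; first by rewrite U0 trmx0.
  by case: (step i.+1) => [|_ [/symmetricmxE]]; first lia.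
have rotU i : (i <= k)%N -> rotate (Q *m H) (U i) = rotate Q (U i).
  move=> le_ik; rewrite rotateM.
  apply: (@rotate_fixes_supported _ _ (s i)); last exact: cornU.
    by apply: fixes_lead_le fixH; apply: s_le.
  by rewrite tr_rotate symU.
(* The trailing coordinates span a subspace of the kernel of the rotated U_k. *)
have tailV : rotate (tail_proj R n a) (rotate (Q *m H) (V k.+1)) = 0.
  rewrite -rotateM; apply: tan_kernel tanV _.
  have : rotate (Q *m H) (U k) *m tail_proj R n a = 0.
    by rewrite rotU // /tail_proj mulmxBr mulmx1 cornU // subrr.
  move: QHQH; set P := Q *m H => PP /(congr1 (mulmx P)).
  by rewrite mulmx0 /rotate !mulmxA (mulmx1C PP) mul1mx -mulmxA.
pose s' i := if (i <= k)%N then s i else t.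
exists (Q *m H), s'; split=> //.
- move=> i; rewrite /s'; case: (ltngtP i k) => [_ | _ | ->].
  + exact: s_mono.
  + by rewrite leqnn t_n.
  + by rewrite a_t t_n.
- move=> i; rewrite /s' => /andP[i_gt0]; rewrite leq_eqVlt => /predU1P[->|i_k].
    by rewrite ltnn /= leqnn Yk rotateD rotateD tailV addr0 tailQH.
  have -> : (i.-1 <= k)%N by lia.
  rewrite ltnS in i_k; rewrite i_k.
  have blk := blkY i; rewrite i_gt0 i_k in blk; have {}blk := blk isT.
  rewrite rotateM rotate_tail_fixes; last first.
    by apply: fixes_lead_le fixH; apply: s_le; lia.
  rewrite (@rotate_fixes_supported _ _ (s i)) //.
  + by apply: fixes_lead_le fixH; apply: s_le.
  + exact: pd_diag_block_sym blk.
  + exact: pd_diag_block_lead blk.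
move=> i; rewrite /s' leq_eqVlt => /predU1P[->|i_k]; last first.
  by rewrite ltnS in i_k; rewrite i_k rotU // cornU.
rewrite ltnn; apply: tail_vanish_corner; first exact: psdmx_rotate.
(* Its trailing block from t on is a trailing block of the diagonal matrix
   obtained from N, beyond the positive entries. *)
rewrite -(mul_tail R n a_t) rotateM tailQH.
apply/matrixP=> p q; rewrite rotate_tailE [RHS]mxE.
case: ifP => // /andP[t_p t_q]; have := blkN p q.
by case: ifP => //; lia.
Qed.

(** * Regular facial reduction sequences *)

Lemma block_endS r i : block_end r i.+1 = (block_end r i + r i.+1)%N.
Proof. by rewrite /block_end big_nat_recr. Qed.

Lemma block_end_le r i j : (i <= j)%N -> (block_end r i <= block_end r j)%N.
Proof.
apply: (homo_leq (r := leq) leqnn leq_trans) => k.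
by rewrite block_endS leq_addr.
Qed.

(** Regularity with given sizes, without the separate matrices Lambda_i: a
    diagonal matrix is positive definite exactly when its diagonal entries are
    positive. *)
Lemma regfr_sizesE (R : realType) n k (Y : nat -> 'M[R]_n) r :
  regfr_sizes k Y r <->
  (block_end r k <= n)%N /\
  forall i, (1 <= i <= k)%N ->
    Y i \is symmetricmx /\
    pd_diag_block (block_end r i.-1) (block_end r i)
      (rotate (tail_proj R n (block_end r i.-1)) (Y i)).
Proof.
split=> -[le_n regY]; split=> // i ik; have [symY] := regY i ik;
  have bE : block_end r i = (block_end r i.-1 + r i)%N
    by case: i ik {regY symY} => // i _; rewrite block_endS.
- case=> L [diagL pdL LE Y0]; split=> // p q; rewrite rotate_tailE.
  case: ifP => [/andP[/eqP <- /andP[s_p p_t]] | nblk].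
    rewrite s_p /=; have p_r : (p - block_end r i.-1 < r i)%N by lia.
    rewrite (LE p p (Ordinal p_r) (Ordinal p_r)) /=; try lia.
    have [_ /(_ (delta_mx (Ordinal p_r) 0))] := pdL.
    rewrite trmx_delta -rowE -colE !mxE; apply.
    apply/eqP=> /matrixP/(_ (Ordinal p_r) 0)/eqP.
    by rewrite !mxE !eqxx oner_eq0.
  case: ifP => // /andP[s_p s_q].
  have [out|] := boolP ((block_end r i <= p) || (block_end r i <= q))%N.
    exact: Y0.
  rewrite negb_or -!ltnNge => /andP[p_t q_t].
  have p_r : (p - block_end r i.-1 < r i)%N by lia.
  have q_r : (q - block_end r i.-1 < r i)%N by lia.
  rewrite (LE p q (Ordinal p_r) (Ordinal q_r)) /=; try lia.
  move/is_diag_mxP: diagL; apply => /=; apply: contraFneq nblk => pq.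
  by rewrite -val_eqE /=; lia.
move=> blkY; split=> //.
have t_n : (block_end r i <= n)%N.
  by apply: leq_trans le_n; apply: block_end_le; lia.
have in_n (a : 'I_(r i)) : (block_end r i.-1 + a < n)%N.
  by have := ltn_ord a; lia.
pose f a := Ordinal (in_n a).
have YE (p q : 'I_n) : (block_end r i.-1 <= p)%N -> (block_end r i.-1 <= q)%N ->
    if (p == q) && (block_end r i.-1 <= p < block_end r i)%N
    then (0 < Y i p q : Prop) else Y i p q = 0.
  by move=> s_p s_q; have := blkY p q; rewrite rotate_tailE s_p s_q.
pose L := \matrix_(a, c) Y i (f a) (f c).
have Ldiag a c : if a == c then (0 < L a c : Prop) else L a c = 0.
  have := YE (f a) (f c); rewrite !leq_addr mxE -val_eqE /= eqn_add2l val_eqE.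
  by move=> /(_ isT isT); rewrite bE ltn_add2l ltn_ord andbT.
exists L; split.
- by apply/is_diag_mxP=> a c ne; have := Ldiag a c; rewrite -val_eqE (negPf ne).
- split.
    apply/symmetricmxE/matrixP=> a c; rewrite [LHS]mxE.
    have := Ldiag a c; have := Ldiag c a; rewrite eq_sym.
    by have [-> | _] := eqVneq a c => // -> ->.
  move=> x x_neq0.
  have -> : (x^T *m L *m x) 0 0 = \sum_a L a a * x a 0 ^+ 2.
    rewrite mxE; apply: eq_bigr => c _.
    rewrite mxE (bigD1 c) //= big1 => [|a ne].
      by rewrite addr0 mxE mulrC mulrA mulrC expr2 mulrA.
    by have := Ldiag a c; rewrite (negPf ne) => ->; rewrite mulr0.
  have Lpos a : 0 < L a a by have := Ldiag a a; rewrite eqxx.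
  have term_ge0 a : true -> 0 <= L a a * x a 0 ^+ 2.
    by rewrite mulr_ge0 ?sqr_ge0 // ltW.
  rewrite lt_def sumr_ge0 ?andbT //; apply: contra_neq x_neq0 => sum0.
  apply/colP=> a; rewrite [RHS]mxE; apply/eqP.
  have /eqP : L a a * x a 0 ^+ 2 = 0 by apply: (psumr_eq0P term_ge0 sum0).
  by rewrite mulf_eq0 (gt_eqF (Lpos a)) sqrf_eq0.
- move=> p q a c pE qE; rewrite mxE; congr (Y i _ _); exact: val_inj.
- move=> p q s_p s_q out; have := YE p q s_p s_q.
  by case: ifP => // /andP[/eqP pq]; move: out; rewrite pq; lia.
Qed.

(** * The rotated dual solution *)

Theorem theorem3 (R : realType) (m n : nat)
    (A : 'I_m -> 'M[R]_n) (C : 'M[R]_n) (b : 'cV[R]_m)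
    (symA : forall i : 'I_m, A i \is symmetricmx) (symC : C \is symmetricmx)
    (feasP : primal_feasible A b)
    (y : 'cV[R]_m) (ys : nat -> 'cV[R]_m) (U V : nat -> 'M[R]_n)
    (feasD : ramana_feasible A C b y ys U V) :
  exists Q : 'M[R]_n,
    let A' : 'I_m -> 'M[R]_n := fun i => rotate Q (A i) in
    let U' : nat -> 'M[R]_n := fun i => rotate Q (U i) in
    let Y : nat -> 'M[R]_n := fun i => adjA A' (ys i) in
    [/\ Q^T *m Q = 1%:M,
        regfr n.-1 Y
      & forall r : nat -> nat, regfr_sizes n.-1 Y r ->
          forall i : nat, (1 <= i <= n.-1)%N ->
            psd_corner (block_end r i) (U' i)].
Proof.
have [symUV _ U0 _ step] := feasD.
have [Q [s [QQ s0 s_mono blkY cornU]]] :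
    exists Q s, regular_rotation (fun i => adjA A (ys i)) U n.-1 Q s.
  by apply: (regular_rotation_exists (V := V)) => // i /step[].
exists Q => A' U' Y.
have YE i : Y i = rotate Q (adjA A (ys i)) by exact: adjA_rotate.
have s_n i : (s i <= n)%N by have := s_mono i; lia.
have symY i : (1 <= i <= n.-1)%N -> Y i \is symmetricmx.
  move=> ik; have [adjE _ _ _] := step i ik.
  have [|/symmetricmxE symU /symmetricmxE symV] := symUV i; first lia.
  by apply/symmetricmxE; rewrite YE adjE tr_rotate linearD /= symU symV.
pose r i := (s i - s i.-1)%N.
have block_end_r i : block_end r i = s i.
  elim: i => [|i IHi]; first by rewrite /block_end big_nil s0.
  by rewrite block_endS IHi /r /=; have := s_mono i; lia.
split=> // [|r' /regfr_sizesE[le_n regY] i /andP[_ le_i]].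
  exists r; apply/regfr_sizesE; split; first by rewrite block_end_r.
  move=> i ik; rewrite !block_end_r YE -{1}YE.
  by split; [exact: symY | exact: blkY].
(* The sizes are determined by the sequence, one after the other. *)
have -> : block_end r' i = s i.
  elim: i le_i => [|i IHi] le_i; first by rewrite /block_end big_nil s0.
  have [|_] := regY i.+1; first lia.
  have := blkY i.+1; rewrite /= IHi ?(ltnW le_i) // le_i -YE.
  move=> /(_ isT) blk blk'.
  apply: pd_diag_block_end_inj blk' blk; last exact: s_mono.
  rewrite -{1}(IHi (ltnW le_i)) block_end_le //=.
  exact: leq_trans (block_end_le _ le_i) le_n.
have corn := cornU i le_i.
have psdU' : psdmx (U' i).
  apply: psdmx_rotate; case: i le_i {corn} => [|i] le_i; last first.
    by case: (step i.+1).
  rewrite U0; split=> [|x]; last by rewrite mulmx0 mul0mx mxE.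
  by apply/symmetricmxE; rewrite trmx0.
split=> // p q; have [/symmetricmxE symU' _] := psdU'.
have E j l : U' i j l = if (l < s i)%N then U' i j l else 0.
  by rewrite -mulmx_leadE corn.
rewrite negb_and => /orP[p_s | q_s]; last by rewrite E (negPf q_s).
by rewrite -symU' mxE E (negPf p_s).
Qed.
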